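(* Let $X_1,\dots,X_n$ be any real-valued random variables (defined on a common probability space) such that for each $j\in\{1,\dots,n\}$ there is some $t\in(0,\infty)$ with $\mathsf{E}\,e^{tX_j}<\infty$. Then for all $u\in\mathbb{R}$ $$\mathsf{P}\big(X_1+\dots+X_n>{L_{X_1}^*}^{-1}(u)+\dots+{L_{X_n}^*}^{-1}(u)\big)\le e^{-u}.$$
   Context: For a real-valued random variable $X$, let $L_X(t):=\ln\mathsf{E}\,e^{tX}\in(-\infty,\infty]$ for $t\in(0,\infty)$. For a function $L\colon(0,\infty)\to[-\infty,\infty]$, its Legendre--Fenchel transform is $L^*(x):=\sup_{t\in(0,\infty)}[tx-L(t)]$ for $x\in\mathbb{R}$, and the (smallest) generalized inverse of $L^*$ is ${L^*}^{-1}(u):=\inf\{x\in\mathbb{R}\colon L^*(x)\ge u\}\in[-\infty,\infty]$ for $u\in\mathbb{R}$, where $\inf\emptyset=\infty$. (If $L$ is not identically $\infty$, then ${L^*}^{-1}(u)<\infty$ for all $u\in\mathbb{R}$, so sums of such values are well defined in $[-\infty,\infty)$.) No independence of the random variables is assumed. *)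

(* Defs.v *)
From mathcomp Require Import all_boot all_order all_algebra.
From mathcomp Require Import all_classical all_reals all_analysis.

Set Implicit Arguments.
Unset Strict Implicit.
Unset Printing Implicit Defensive.

Import Order.TTheory GRing.Theory Num.Theory.
Import numFieldNormedType.Exports.

Local Open Scope classical_set_scope.
Local Open Scope ring_scope.
Local Open Scope ereal_scope.

(* ['M_P X t] is the extended-real expectation of [expR (t * X)], so this is
   [+oo] exactly when that expectation is infinite. *)
Definition log_mgf d (T : measurableType d) (R : realType)
    (P : probability T R) (X : {RV P >-> R}) (t : R) : \bar R :=
  lne ('M_P X t).

(* Only the values of [L] on the positive reals matter. *)
Definition legendre_fenchel (R : realType) (L : R -> \bar R) (x : R) : \bar R :=
  ereal_sup [set (t * x)%:E - L t | t in `]0%R, +oo[].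

Definition gen_inv (R : realType) (f : R -> \bar R) (u : R) : \bar R :=
  ereal_inf [set x%:E | x in [set x : R | u%:E <= f x]].

(* Main.v *)
(** If the j-th Legendre-Fenchel transform is at least [u] at [x j], then for
    every [v < u] some [t j > 0] satisfies [E exp Y_j <= exp (- v)], where
    [Y_j = t j * (X j - x j)]. With weights [p j] proportional to [1 / t j] and
    summing to 1, the combination [\sum_j p j * Y_j] is a positive multiple of
    [\sum_j (X j - x j)]. On the event where it is nonnegative,
    [\sum_j p j * exp Y_j >= \sum_j p j * (1 + Y_j) >= 1], so by taking
    expectations the event has probability at most [exp (- v)]; no independence
    is involved. Letting [v] tend to [u], then [x j] decrease to the
    generalized inverse, gives the bound. *)
Require Import Defs.
From mathcomp Require Import all_boot all_order all_algebra.
From mathcomp Require Import all_classical all_reals all_analysis.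
From mathcomp Require Import measurable_realfun lra.

Set Implicit Arguments.
Unset Strict Implicit.
Unset Printing Implicit Defensive.

Import Order.TTheory GRing.Theory Num.Theory.
Import numFieldNormedType.Exports.

Local Open Scope classical_set_scope.
Local Open Scope ring_scope.
Local Open Scope ereal_scope.

(** Reduces a possibly infinite threshold [a] to real thresholds [s] above it: as [s] decreases to
    [a], [ccdf S s] tends to the probability on the left, by right continuity when [a] is real and
    by the limit 1 at minus infinity when [a] is [-oo]. *)
Lemma prob_gt_le d (T : measurableType d) (R : realType) (P : probability T R)
    (S : {RV P >-> R}) (a c : \bar R) : a < +oo ->
  (forall s : R, a < s%:E -> ccdf S s <= c) -> P [set w | a < (S w)%:E] <= c.
Proof.
case: a => [r| |]// _ Sc.
- have -> : [set w | r%:E < (S w)%:E] = S @^-1` `]r, +oo[.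
    by apply/seteqP; split => w /=; rewrite in_itv/= andbT lte_fin.
  have cS := @ccdf_right_continuous _ _ _ P S r.
  rewrite -[P _]/(ccdf S r) -(cvg_lim _ cS)//.
  apply: lime_le; first by apply/cvg_ex; exists (ccdf S r).
  by near=> s; apply: Sc; rewrite lte_fin; near: s; exact: nbhs_right_gt.
- have cS := @cvg_ccdfNy1 _ _ _ P S.
  apply: (@le_trans _ _ 1).
    rewrite [X in P X](_ : _ = setT) ?probability_setT//.
    by apply/seteqP; split => w //= _; rewrite ltNyr.
  rewrite -(cvg_lim _ cS)//.
  apply: lime_le; first by apply/cvg_ex; exists 1.
  by near=> s; apply: Sc; rewrite ltNyr.
Unshelve. all: by end_near. Qed.

Lemma adde_lt_split (R : realType) (a b : \bar R) (s : R) :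
  a < +oo -> b < +oo -> a + b < s%:E ->
  exists x y : R, [/\ a < x%:E, b < y%:E & (x + y)%R = s].
Proof.
case: a b => [p| |] [q| |] // _ _.
(* Each summand receives half of the slack; when a term is [-oo], its real counterpart absorbs
   whatever remains. *)
- rewrite -EFinD lte_fin => pqs; pose e := ((s - p - q) / 2)%R.
  by exists (p + e)%R, (q + e)%R; split; rewrite ?lte_fin /e; lra.
- move=> _; exists (p + 1)%R, (s - p - 1)%R.
  by split; rewrite ?ltNyr ?lte_fin//; lra.
- move=> _; exists (s - q - 1)%R, (q + 1)%R.
  by split; rewrite ?ltNyr ?lte_fin//; lra.
- by move=> _; exists s, 0%R; split; rewrite ?ltNyr ?addr0.
Qed.

(** The conclusion is an inequality because for [n = 0] the empty sum cannot be adjusted to equal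
    [s]. *)
Lemma sume_lt_split (R : realType) (n : nat) (a : 'I_n -> \bar R) (s : R) :
  (forall j, a j < +oo) -> \sum_(j < n) a j < s%:E ->
  exists2 x : 'I_n -> R, forall j, a j < (x j)%:E & (\sum_(j < n) x j <= s)%R.
Proof.
elim: n a s => [|n IH] a s aoo.
  rewrite big_ord0 lte_fin => s0.
  by exists (fun=> 0%R); [case|rewrite big_ord0 ltW].
rewrite big_ord_recl => /adde_lt_split[||x0 [y [ax0 ay <-]]]; first exact: aoo.
  by apply: lte_sum_pinfty => j _; exact: aoo.
have [x ax xy] := IH _ _ (fun j => aoo (lift ord0 j)) ay.
exists (fun j => if unlift ord0 j is Some i then x i else x0) => [j|].
  by case: unliftP => [i ->|->].
rewrite big_ord_recl unlift_none lerD2l.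
by under eq_bigr do rewrite liftK.
Qed.

Lemma prob_convex_comb_ge0_le d (T : measurableType d) (R : realType)
    (P : probability T R) (n : nat) (Y : 'I_n -> T -> R) (p : 'I_n -> R)
    (c : R) :
  (forall j, measurable_fun setT (Y j)) -> (forall j, 0 <= p j)%R ->
  (\sum_(j < n) p j = 1)%R ->
  (forall j, \int[P]_w (expR (Y j w))%:E <= c%:E) ->
  P [set w | 0 <= \sum_(j < n) p j * Y j w]%R <= c%:E.
Proof.
move=> mY p0 p1 Yc; set E := [set w | _].
have mE : measurable E.
  rewrite -[E]setTI; apply: (measurable_fun_ler (f := cst 0%R)) => //.
  by apply: measurable_sum => j; exact: measurable_funM.
have mZ j : measurable_fun setT (fun w => (p j)%:E * (expR (Y j w))%:E).
  apply: emeasurable_funM => //; apply/measurable_EFinP.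
  exact: measurableT_comp (mY j).
have Z0 j w : 0 <= (p j)%:E * (expR (Y j w))%:E.
  by rewrite -EFinM lee_fin mulr_ge0 ?expR_ge0.
have mS D : measurable D ->
    measurable_fun D (fun w => \sum_(j < n) (p j)%:E * (expR (Y j w))%:E).
  move=> mD; apply: (measurable_funS measurableT) => //.
  exact: emeasurable_sum.
rewrite -[P E]mul1e -(integral_cst P mE 1).
have : \int[P]_(w in E) cst 1 w <=
       \int[P]_(w in E) \sum_(j < n) (p j)%:E * (expR (Y j w))%:E.
  apply: ge0_le_integral => //; first exact: mS.
  move=> w /= Ew; under eq_bigr do rewrite -EFinM.
  rewrite sumEFin lee_fin.
  apply: (@le_trans _ _ (\sum_(j < n) p j * (1 + Y j w))%R).
    under eq_bigr do rewrite mulrDr mulr1.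
    by rewrite big_split/= p1 lerDl.
  by apply: ler_sum => j _; rewrite ler_wpM2l// expR_ge1Dx.
move=> /le_trans; apply.
apply: (@le_trans _ _ (\int[P]_w \sum_(j < n) (p j)%:E * (expR (Y j w))%:E)).
  by apply: ge0_subset_integral => //; [exact: mS | move=> w _; exact: sume_ge0].
rewrite ge0_integral_sum//.
apply: (@le_trans _ _ (\sum_(j < n) (p j)%:E * c%:E)).
  apply: lee_sum => j _; rewrite ge0_integralZl_EFin//; last first.
    by apply/measurable_EFinP; exact: measurableT_comp (mY j).
  by apply: lee_wpmul2l; rewrite ?lee_fin.
by under eq_bigr do rewrite -EFinM; rewrite sumEFin -mulr_suml p1 mul1r.
Qed.

Lemma log_mgf_le d (T : measurableType d) (R : realType) (P : probability T R)
    (X : {RV P >-> R}) (t r v : R) :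
  v%:E < r%:E - log_mgf X t -> 'M_P X t <= (expR (r - v))%:E.
Proof.
rewrite /log_mgf; case: ('M_P X t) => [m| |]//; last by rewrite leNye.
(* [lne] sends nonpositive reals to [-oo], so that case needs only positivity of the exponential. *)
rewrite /lne; case: ifPn => [m0 _|].
  by rewrite lee_fin (le_trans m0)// expR_ge0.
rewrite -ltNge -EFinB lte_fin ltrBrDr addrC -ltrBrDr => m0 lm.
by rewrite lee_fin -[leLHS]lnK ?posrE// ler_expR ltW.
Qed.

Lemma gen_inv_legendre_fenchel_lty (R : realType) (L : R -> \bar R) (t u : R) :
  (0 < t)%R -> L t < +oo -> gen_inv (legendre_fenchel L) u < +oo.
Proof.
move=> t0 Lt; have [x ux] : exists x : R, u%:E <= (t * x)%:E - L t.
  case: (L t) Lt => [l| |]// _; last by exists 0%R; rewrite addey ?leey.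
  (* This [x] solves [t * x - l = u]. *)
  exists ((u + l) / t)%R.
  by rewrite -EFinB lee_fin mulrCA mulfV ?gt_eqF// mulr1 addrK.
apply: (@le_lt_trans _ _ x%:E); last exact: ltry.
apply: ereal_inf_lbound; exists x => //=.
apply: (le_trans ux); apply: ereal_sup_ubound; exists t => //=.
by rewrite in_itv/= t0.
Qed.

Lemma le_legendre_fenchel_ex (R : realType) (L : R -> \bar R) (u v x : R) :
  u%:E <= legendre_fenchel L x -> (v < u)%R ->
  exists2 t : R, (0 < t)%R & v%:E < (t * x)%:E - L t.
Proof.
move=> uL vu; have /ereal_sup_gt[_ [t + <-] vt] : v%:E < legendre_fenchel L x.
  by apply: lt_le_trans uL; rewrite lte_fin.
by rewrite /= in_itv/= andbT => t0; exists t.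
Qed.

Lemma legendre_fenchel_homo (R : realType) (L : R -> \bar R) :
  {homo legendre_fenchel L : x y / (x <= y)%R >-> x <= y}.
Proof.
move=> x y xy; apply: ge_ereal_sup => _ [t /= + <-].
rewrite in_itv/= andbT => t0; apply: (@le_trans _ _ ((t * y)%:E - L t)).
  by rewrite leeD2r// lee_fin ler_wpM2l// ltW.
by apply: ereal_sup_ubound; exists t => //=; rewrite in_itv/= t0.
Qed.

(** The infimum need not be attained, hence the strict hypothesis: it gives an admissible point
    below [x], and monotonicity of the transform does the rest. *)
Lemma gen_inv_legendre_fenchel_lt (R : realType) (L : R -> \bar R) (u x : R) :
  gen_inv (legendre_fenchel L) u < x%:E -> u%:E <= legendre_fenchel L x.
Proof.
move=> /ereal_inf_lt[_ [y /= uy <-]]; rewrite lte_fin => /ltW yx.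
exact: le_trans uy (legendre_fenchel_homo L yx).
Qed.

Lemma prob_sum_ge_le d (T : measurableType d) (R : realType)
    (P : probability T R) (n : nat) (X : 'I_n.+1 -> {RV P >-> R})
    (x : 'I_n.+1 -> R) (u : R) :
  (forall j, u%:E <= legendre_fenchel (log_mgf (X j)) (x j)) ->
  P [set w | \sum_(j < n.+1) x j <= \sum_(j < n.+1) X j w]%R <= (expR (- u))%:E.
Proof.
move=> ux; apply/lee_addgt0Pr => e e0.
have [v vu vue] : exists2 v, (v < u)%R & (expR (- v) <= expR (- u) + e)%R.
  (* Chosen so that [expR (- v)] is exactly [expR (- u) + e]. *)
  exists (- ln (expR (- u) + e))%R.
    rewrite ltrNl -[ltLHS]expRK ltr_ln ?posrE ?expR_gt0 ?ltrDl//.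
    by rewrite addr_gt0 ?expR_gt0.
  by rewrite opprK lnK// posrE addr_gt0 ?expR_gt0.
have /choice[t tP] j : exists t : R,
    (0 < t)%R /\ v%:E < (t * x j)%:E - log_mgf (X j) t.
  by have [t ? ?] := le_legendre_fenchel_ex (ux j) vu; exists t.
pose s := (\sum_(j < n.+1) (t j)^-1)%R.
have s0 : (0 < s)%R.
  rewrite /s big_ord_recl ltr_pwDl ?invr_gt0 ?(tP _).1//.
  by apply: sumr_ge0 => j _; rewrite invr_ge0 ltW ?(tP _).1.
pose Y j w := (t j * (X j w - x j))%R.
pose p j := ((t j)^-1 / s)%R.
apply: (@le_trans _ _ (expR (- v))%:E); last by rewrite lee_fin.
have -> : [set w | \sum_(j < n.+1) x j <= \sum_(j < n.+1) X j w]%R =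
          [set w | 0 <= \sum_(j < n.+1) p j * Y j w]%R.
  apply/funext => w; apply/propext => /=.
  (* The factor [t j] in [Y j] cancels its inverse in [p j], leaving the common factor [1 / s]. *)
  have -> : (\sum_(j < n.+1) p j * Y j w =
             (\sum_(j < n.+1) X j w - \sum_(j < n.+1) x j) / s)%R.
    rewrite -sumrB mulr_suml; apply: eq_bigr => j _; rewrite /p /Y.
    by rewrite mulrACA mulVf ?mul1r 1?mulrC// gt_eqF ?(tP _).1.
  by rewrite pmulr_lge0 ?invr_gt0// subr_ge0.
apply: prob_convex_comb_ge0_le => [j|j||j].
- by apply: measurable_funM => //; exact: measurable_funB.
- by rewrite divr_ge0 ?invr_ge0 ?ltW ?(tP _).1.
- by rewrite -mulr_suml mulfV ?gt_eqF.
- have -> : \int[P]_w (expR (Y j w))%:E =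
      (expR (- (t j * x j)))%:E * 'M_P (X j) (t j).
    rewrite /mmt_gen_fun unlock -ge0_integralZl_EFin ?expR_ge0//.
    + apply: eq_integral => w _; rewrite -EFinM -expRD /Y.
      congr (expR _)%:E => /=.
      by rewrite mulrBr addrC [X in (_ + X)%R]mulrC.
    + by move=> w _; rewrite lee_fin expR_ge0.
    + by apply/measurable_EFinP; exact: measurableT_comp.
  (* The choice of [t j] bounds the moment generating function by [expR (t j * x j - v)]; the two
     exponents then add up to [- v]. *)
  apply: (@le_trans _ _ ((expR (- (t j * x j)))%:E * (expR (t j * x j - v))%:E)).
    by apply: lee_wpmul2l; [rewrite lee_fin expR_ge0|exact: log_mgf_le (tP j).2].
  by rewrite -EFinM -expRD addKr.
Qed.

Theorem corollary2p2 (d : measure_display) (T : measurableType d)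
    (R : realType) (P : probability T R) (n : nat) (X : 'I_n -> {RV P >-> R})
    (hX : forall j : 'I_n, exists2 t : R, (0 < t)%R & 'M_P (X j) t < +oo)
    (u : R) :
  P [set w | \sum_(j < n) gen_inv (legendre_fenchel (log_mgf (X j))) u
             < (\sum_(j < n) X j w)%R%:E]
    <= (expR (- u))%:E.
Proof.
(* With no variables the event is [0 < 0]; the weights [p j] require a nonempty family. *)
case: n => [|n] in X hX *.
  rewrite [X in P X](_ : _ = set0) ?measure0 ?lee_fin ?expR_ge0//.
  by apply/seteqP; split => w //=; rewrite !big_ord0 ltxx.
set a := fun j => gen_inv (legendre_fenchel (log_mgf (X j))) u.
have aoo j : a j < +oo.
  have [t t0 Mt] := hX j; apply: gen_inv_legendre_fenchel_lty t0 _.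
  rewrite /log_mgf; case: ('M_P (X j) t) Mt => [m| |]//= _.
  by case: ifP => // _; exact: ltry.
pose S : {RV P >-> R} := (\sum_(j < n.+1) X j)%R.
have SE w : S w = (\sum_(j < n.+1) X j w)%R by rewrite mfun_sum.
have -> : [set w | \sum_(j < n.+1) a j < (\sum_(j < n.+1) X j w)%R%:E] =
          [set w | \sum_(j < n.+1) a j < (S w)%:E].
  by apply/funext => w /=; rewrite SE.
apply: prob_gt_le => [|s /(sume_lt_split aoo)[x ax xs]].
  by apply: lte_sum_pinfty => j _; exact: aoo.
(* Since the [x j] sum to at most [s], the event [S > s] lies in the one bounded by
   [prob_sum_ge_le]. *)
apply: le_trans (prob_sum_ge_le (fun j => gen_inv_legendre_fenchel_lt (ax j))).
apply: (@le_measure _ _ _ P); rewrite ?inE /=.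
- exact: (measurable_funPTI S).
- rewrite -[X in measurable X]setTI.
  apply: (measurable_fun_ler (f := cst _)) => //.
  exact: measurable_sum.
- by move=> w; rewrite /= in_itv/= andbT SE => sw; rewrite (le_trans xs)// ltW.
Qed.
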